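(* Let $G$ be an atomic bispanning graph with vertex-connectivity $2$, and suppose $G$ is the 2-clique sum of two simple bispanning graphs $G_1=(V_1,E_1)$ and $G_2=(V_2,E_2)$ at edges $d_1\in E_1$, $d_2\in E_2$ (i.e. $G$ arises from the disjoint union of $G_1$ and $G_2$ by identifying the ends of $d_1$ with the ends of $d_2$ and deleting $d_1$ and $d_2$). Define the directed graph $\eta=\eta_{d_1,d_2}(\vec\tau_3(G_1),\vec\tau_3(G_2))$ as follows. Its vertex set is $$V_\eta=\{((S_1,T_1),(S_2,T_2))\in V_{\tau(G_1)}\times V_{\tau(G_2)} : \text{not }((d_1\in S_1\text{ and } d_2\in S_2)\text{ or }(d_1\in T_1\text{ and }d_2\in T_2))\}.$$ Its arcs are the tuples $(e,f,(S_1,T_1),(S_2,T_2))$ with $((S_1,T_1),(S_2,T_2))\in V_\eta$ satisfying one of: (a) $(e,f,S_1,T_1)$ is an arc of $\vec\tau_3(G_1)$ and $e\neq d_1\neq f$; (b) $(e,f,S_2,T_2)$ is an arc of $\vec\tau_3(G_2)$ and $e\neq d_2\neq f$; (c) $(e,d_1,S_1,T_1)$ is an arc of $\vec\tau_3(G_1)$ and $(d_2,f,S_2,T_2)$ is an arc of $\vec\tau_3(G_2)$; (d) $(e,d_2,S_2,T_2)$ is an arc of $\vec\tau_3(G_2)$ and $(d_1,f,S_1,T_1)$ is an arc of $\vec\tau_3(G_1)$. Each such arc goes from $((S_1,T_1),(S_2,T_2))$ to: in case (a), $((S_1-e+f,T_1+e-f),(S_2,T_2))$ if $e\in S_1,f\in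 T_1$, and $((S_1+e-f,T_1-e+f),(S_2,T_2))$ if $e\in T_1,f\in S_1$; in case (b), analogously $((S_1,T_1),(S_2-e+f,T_2+e-f))$ if $e\in S_2,f\in T_2$ and $((S_1,T_1),(S_2+e-f,T_2-e+f))$ if $e\in T_2,f\in S_2$; in case (c), $((S_1-e+d_1,T_1+e-d_1),(S_2-d_2+f,T_2+d_2-f))$ if $e\in S_1,f\in T_2$, and $((S_1+e-d_1,T_1-e+d_1),(S_2+d_2-f,T_2-d_2+f))$ if $e\in T_1,f\in S_2$; in case (d), $((S_1-d_1+f,T_1+d_1-f),(S_2-e+d_2,T_2+e-d_2))$ if $e\in S_2,f\in T_1$, and $((S_1+d_1-f,T_1-d_1+f),(S_2+e-d_2,T_2-e+d_2))$ if $e\in T_2,f\in S_1$. Then $\vec\tau_3(G)\cong\eta$.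
   Context: Graphs are finite, undirected, may have parallel edges, no loops. $X+a=X\cup\{a\}$, $X-a=X\setminus\{a\}$. A spanning tree of $G=(V,E)$ is $T\subseteq E$ with $(V,T)$ connected and acyclic; $G$ is bispanning if $E$ is the disjoint union of two spanning trees. A bispanning graph is atomic if it contains no bispanning subgraph other than itself and a single vertex. Vertex-connectivity is the largest $k$ with $|V|>k$ such that deleting fewer than $k$ vertices leaves $G$ connected. For a spanning tree $T$ and $e\notin T$, $C_G(T,e)$ is the edge set of the unique cycle in $T+e$; for $e\in T$, $D_G(T,e)$ is the set of edges of $G$ with one end in each component of $(V,T-e)$. For disjoint spanning trees $S,T$ with $S\cup T=E$: $(e,f)$ with $e\in S,f\in T$, $D_G(S,e)\cap C_G(T,e)=\{e,f\}$ is a unique $S$ edge exchange; $(e,f)$ with $e\in T,f\in S$, $D_G(T,e)\cap C_G(S,e)=\{e,f\}$ is a unique $T$ edge exchange. $\vec\tau_3(G)$: vertex set $V_{\tau(G)}$ of ordered pairs $(S,T)$ of disjoint spanning trees with $S\cup T=E$; arcs are quadruples $(e,f,S,T)$ where $(e,f)$ is a unique $S$ edge exchange (arc to $(S-e+f,T+e-f)$) or a unique $T$ edge exchange (arc to $(S+e-f,T-e+f)$) for $(S,T)$. Isomorphism of directed multigraphs: bijections on vertices and arcs preserving tails and heads. *)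

(* Defs.v *)
From mathcomp Require Import all_boot.
Set Implicit Arguments.
Unset Strict Implicit.
Unset Printing Implicit Defensive.

(* A finite undirected multigraph: vertex type, edge type, and the two ends
   of each edge (the order of the pair is irrelevant everywhere below). *)
Record graph := Graph { vtx : finType; edg : finType; ends : edg -> vtx * vtx }.

Section GraphDefs.
Variable G : graph.
Local Notation V := (vtx G).
Local Notation E := (edg G).

Definition loopless := forall e : E, (ends e).1 != (ends e).2.
Definition parallel (e e' : E) :=
  (ends e == ends e') || (ends e == ((ends e').2, (ends e').1)).
Definition simple := loopless /\ forall e e' : E, e != e' -> ~~ parallel e e'.

Definition link (A : {set E}) : rel V :=
  fun u v => [exists e in A, (ends e == (u, v)) || (ends e == (v, u))].
Definition conn (A : {set E}) (u v : V) : bool := connect (link A) u v.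

Definition deg (C : {set E}) (v : V) : nat :=
  \sum_(e in C) (((ends e).1 == v) + ((ends e).2 == v)).

Definition is_cycle (C : {set E}) : bool :=
  [&& C != set0,
      [forall v, (deg C v == 0) || (deg C v == 2)] &
      [forall u, forall v, ((deg C u != 0) && (deg C v != 0)) ==> conn C u v]].

Definition acyclic (A : {set E}) : bool :=
  [forall C : {set E}, (C \subset A) ==> ~~ is_cycle C].

Definition spanning_tree_on (W : {set V}) (A : {set E}) (T : {set E}) : bool :=
  [&& T \subset A, [forall u in W, forall v in W, conn T u v] & acyclic T].

Definition spanning_tree (T : {set E}) := spanning_tree_on setT setT T.

Definition subgraph (W : {set V}) (A : {set E}) :=
  forall e, e \in A -> ((ends e).1 \in W) && ((ends e).2 \in W).

Definition bispanning_on (W : {set V}) (A : {set E}) : bool :=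
  [exists S : {set E}, exists T : {set E},
    [&& spanning_tree_on W A S, spanning_tree_on W A T,
        [disjoint S & T] & S :|: T == A]].

Definition bispanning := bispanning_on setT setT.

Definition atomic :=
  bispanning /\
  forall (W : {set V}) (A : {set E}), W != set0 -> subgraph W A ->
    bispanning_on W A -> (W = setT /\ A = setT) \/ #|W| = 1.

Definition connected_minus (X : {set V}) :=
  forall u v : V, u \notin X -> v \notin X ->
    conn [set e | ((ends e).1 \notin X) && ((ends e).2 \notin X)] u v.

Definition kconnected (k : nat) :=
  k < #|V| /\ forall X : {set V}, #|X| < k -> connected_minus X.

Definition vertex_connectivity (k : nat) :=
  kconnected k /\ forall k', kconnected k' -> k' <= k.

Definition Dcut (T : {set E}) (e : E) : {set E} :=
  [set g | ~~ conn (T :\ e) (ends g).1 (ends g).2].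

(* C_G(T,e): the edge set of the (unique) cycle contained in T + e *)
Definition Ccyc (T : {set E}) (e : E) : {set E} :=
  odflt set0 [pick C : {set E} | is_cycle C && (C \subset e |: T)].

Definition uexS (S T : {set E}) (e f : E) :=
  [&& e \in S, f \in T & Dcut S e :&: Ccyc T e == [set e; f]].
Definition uexT (S T : {set E}) (e f : E) :=
  [&& e \in T, f \in S & Dcut T e :&: Ccyc S e == [set e; f]].

Definition tau_vertex (p : {set E} * {set E}) : bool :=
  [&& spanning_tree p.1, spanning_tree p.2, [disjoint p.1 & p.2] & p.1 :|: p.2 == setT].

Definition tau_arc (a : E * E * ({set E} * {set E})) : bool :=
  let: (e, f, p) := a in tau_vertex p && (uexS p.1 p.2 e f || uexT p.1 p.2 e f).

Definition tau_head (a : E * E * ({set E} * {set E})) : {set E} * {set E} :=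
  let: (e, f, p) := a in
  if e \in p.1 then ((p.1 :\ e) :|: [set f], (p.2 :|: [set e]) :\ f)
  else ((p.1 :|: [set e]) :\ f, (p.2 :\ e) :|: [set f]).

Definition tau_tail (a : E * E * ({set E} * {set E})) := a.2.

End GraphDefs.

(* Directed multigraphs: vertices/arcs are the elements of ambient types
   satisfying a predicate; arcs have a tail and a head. *)
Record dmg := DMG {
  dV : Type; dA : Type;
  isV : dV -> Prop; isA : dA -> Prop;
  tl : dA -> dV; hd : dA -> dV }.

Definition dmg_iso (H K : dmg) : Prop :=
  exists (fV : dV H -> dV K) (gV : dV K -> dV H)
         (fA : dA H -> dA K) (gA : dA K -> dA H),
    (forall x, @isV H x -> @isV K (fV x) /\ gV (fV x) = x) /\
    (forall y, @isV K y -> @isV H (gV y) /\ fV (gV y) = y) /\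
    (forall a, @isA H a -> @isA K (fA a) /\ gA (fA a) = a) /\
    (forall b, @isA K b -> @isA H (gA b) /\ fA (gA b) = b) /\
    (forall a, @isA H a -> @tl K (fA a) = fV (@tl H a) /\ @hd K (fA a) = fV (@hd H a)).

Definition tau3 (G : graph) : dmg :=
  @DMG ({set edg G} * {set edg G}) (edg G * edg G * ({set edg G} * {set edg G}))
    (fun p => tau_vertex p) (fun a => tau_arc a) (@tau_tail G) (@tau_head G).

Section CliqueSum.
Variables (G1 G2 : graph) (d1 : edg G1) (d2 : edg G2).

Definition csum_edg : finType :=
  ({e : edg G1 | e != d1} + {e : edg G2 | e != d2})%type.

(* V together with i1, i2 is the result of gluing V1 and V2 by identifying
   the ends of d1 with the ends of d2 *)
Definition clique_sum_maps (V : finType) (i1 : vtx G1 -> V) (i2 : vtx G2 -> V) :=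
  [/\ injective i1, injective i2,
      (forall x y, i1 x = i2 y <->
         (x = (ends d1).1 /\ y = (ends d2).1) \/ (x = (ends d1).2 /\ y = (ends d2).2)) &
      forall v, (exists x, i1 x = v) \/ (exists y, i2 y = v)].

Definition csum_ends (V : finType) (i1 : vtx G1 -> V) (i2 : vtx G2 -> V)
  (x : csum_edg) : V * V :=
  match x with
  | inl e => (i1 (ends (val e)).1, i1 (ends (val e)).2)
  | inr e => (i2 (ends (val e)).1, i2 (ends (val e)).2)
  end.

Definition csum (V : finType) (i1 : vtx G1 -> V) (i2 : vtx G2 -> V) : graph :=
  @Graph V csum_edg (csum_ends i1 i2).

Local Notation E1 := (edg G1).
Local Notation E2 := (edg G2).
Definition eta_V := (({set E1} * {set E1}) * ({set E2} * {set E2}))%type.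
Definition eta_A := ((E1 + E2) * (E1 + E2) * eta_V)%type.

Definition eta_vertex (q : eta_V) : Prop :=
  tau_vertex q.1 /\ tau_vertex q.2 /\
  ~ ((d1 \in q.1.1 /\ d2 \in q.2.1) \/ (d1 \in q.1.2 /\ d2 \in q.2.2)).

Definition eta_arc (a : eta_A) : Prop :=
  let: (e, f, q) := a in
  eta_vertex q /\
  match e, f with
  | inl e, inl f => tau_arc (e, f, q.1) /\ e != d1 /\ f != d1
  | inr e, inr f => tau_arc (e, f, q.2) /\ e != d2 /\ f != d2
  | inl e, inr f => tau_arc (e, d1, q.1) /\ tau_arc (d2, f, q.2)
  | inr e, inl f => tau_arc (e, d2, q.2) /\ tau_arc (d1, f, q.1)
  end.

Definition eta_tail (a : eta_A) : eta_V := a.2.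

Definition eta_head (a : eta_A) : eta_V :=
  let: (e, f, q) := a in
  let: ((S1, T1), (S2, T2)) := q in
  match e, f with
  | inl e, inl f => (tau_head (e, f, (S1, T1)), (S2, T2))
  | inr e, inr f => ((S1, T1), tau_head (e, f, (S2, T2)))
  | inl e, inr f =>
      if e \in S1 then
        (((S1 :\ e) :|: [set d1], (T1 :|: [set e]) :\ d1),
         ((S2 :\ d2) :|: [set f], (T2 :|: [set d2]) :\ f))
      else
        (((S1 :|: [set e]) :\ d1, (T1 :\ e) :|: [set d1]),
         ((S2 :|: [set d2]) :\ f, (T2 :\ d2) :|: [set f]))
  | inr e, inl f =>
      if e \in S2 then
        (((S1 :\ d1) :|: [set f], (T1 :|: [set d1]) :\ f),
         ((S2 :\ e) :|: [set d2], (T2 :|: [set e]) :\ d2))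
      else
        (((S1 :|: [set d1]) :\ f, (T1 :\ d1) :|: [set f]),
         ((S2 :|: [set e]) :\ d2, (T2 :\ e) :|: [set d2]))
  end.

Definition eta : dmg := @DMG eta_V eta_A eta_vertex eta_arc eta_tail eta_head.

End CliqueSum.

(* Main.v *)
(** The edge sets [A] of a graph carry the closure operator of the graphic
    matroid: [A] spans [e] when it connects the ends of [e].  Spanning trees are
    the bases, [g] lies in [D(S,e)] iff [S - e] does not span [g], and [g] lies
    in [C(T,e)] iff [T - g] does not span [e].

    In the clique sum, [A] connects two vertices of the first side iff its trace
    on that side does, after adding [d1] when its trace on the other side joins
    the two shared vertices.  Hence a spanning tree of [G] joins the shared
    vertices inside exactly one side, and adding [d1] or [d2] on the other side
    yields spanning trees of both summands.  Counting edges, two disjoint trees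
    covering [G] use different sides, which is the condition defining the
    vertices of eta.  Write [Y(e,g)] when exchanging [e] and [g] keeps both
    trees spanning; a unique exchange [(e,f)] means that [f] is the only [g]
    with [Y(e,g)].  For [e], [g] on the same side [Y] is computed in that
    summand, and for [e], [g] on different sides
    [Y(e,g) = Y1(e,d1) && Y2(d2,g)]; this gives the four kinds of arcs of eta. *)
Require Import Defs.
From mathcomp Require Import all_boot.
Set Implicit Arguments.
Unset Strict Implicit.
Unset Printing Implicit Defensive.

(** * The graphic matroid *)

Section GraphicMatroid.
Variable G : graph.
Implicit Types (A B C S T : {set edg G}) (e f g : edg G) (u v w : vtx G).

Lemma linkP A u v :
  reflect (exists2 e, e \in A & ends e = (u, v) \/ ends e = (v, u)) (link A u v).
Proof.
apply: (iffP existsP) => [[e /andP[eA /orP[]/eqP h]]|[e eA h]]; exists e => //; rewrite ?eA; auto.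
by case: h => ->; rewrite eqxx ?orbT.
Qed.

Lemma conn_sym A : symmetric (conn A).
Proof.
move=> u v; apply: sym_connect_sym => {u v} u v.
by apply/linkP/linkP => -[e eA h]; exists e => //; case: h; auto.
Qed.

Lemma conn_refl A u : conn A u u. Proof. exact: connect0. Qed.

Lemma conn_trans A v u w : conn A u v -> conn A v w -> conn A u w.
Proof. exact: connect_trans. Qed.

Definition spans A e := conn A (ends e).1 (ends e).2.

Lemma mem_spans A e : e \in A -> spans A e.
Proof. by move=> eA; apply/connect1/linkP; exists e => //; left; case: (ends e). Qed.

Lemma link_spans A B u v :
  (forall e, e \in A -> spans B e) -> link A u v -> conn B u v.
Proof.
move=> h /linkP[e /h + E]; rewrite /spans; case: E => -> //=.
by rewrite conn_sym.
Qed.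

Lemma conn_closed A B u v :
  (forall e, e \in A -> spans B e) -> conn A u v -> conn B u v.
Proof. by move=> h; apply: connect_sub => x y; apply: link_spans. Qed.

Lemma conn_sub A B u v : A \subset B -> conn A u v -> conn B u v.
Proof. by move=> /subsetP h; apply: conn_closed => e /h; apply: mem_spans. Qed.

Lemma conn_ind A (P : vtx G -> Prop) u v :
  (forall e, e \in A -> P (ends e).1 <-> P (ends e).2) ->
  conn A u v -> P u -> P v.
Proof.
move=> h /connectP[p]; elim: p u => [|w p IH] u /= => [_ -> //|/andP[l pp] lp Pu].
apply: (IH w) => //; case/linkP: l => e /h + E.
by case: E => -> /= [h1 h2]; auto.
Qed.

(** Read as a predicate of [v], the disjunction is invariant along every edge of [f |: A]; its last
    two cases are the two directions of [f]. *)
Lemma conn_setU1 A f u v : conn (f |: A) u v ->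
  [|| conn A u v, conn A u (ends f).1 && conn A (ends f).2 v
    | conn A u (ends f).2 && conn A (ends f).1 v].
Proof.
pose P w := [|| conn A u w, conn A u (ends f).1 && conn A (ends f).2 w
    | conn A u (ends f).2 && conn A (ends f).1 w].
move=> h; apply: (conn_ind (P := P) _ h); rewrite /P; last by rewrite conn_refl.
move=> e /setU1P[->|/mem_spans eA].
  by rewrite !conn_refl; split; case/or3P => [->|/andP[-> _]|/andP[-> _]]; rewrite ?andbT ?orbT.
have E x : conn A x (ends e).1 = conn A x (ends e).2.
  by apply/idP/idP => /conn_trans; apply; rewrite // conn_sym.
by rewrite !E.
Qed.

(** The exchange axiom: a connection between the ends of [e] has to use [f], so rerouting through
    [e] connects the ends of [f]. *)
Lemma spans_exchange A e f :
  spans (f |: A) e -> ~~ spans A e -> spans (e |: A) f.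
Proof.
move=> /conn_setU1 + n; rewrite -/(spans A e) (negPf n) /= => h.
have s u v : conn A u v -> conn (e |: A) u v by apply/conn_sub/subsetU1.
have se : spans (e |: A) e by apply/mem_spans/setU11.
case/orP: h => /andP[/s a /s b]; rewrite /spans.
  by apply: conn_trans (conn_trans se _); rewrite conn_sym.
by rewrite conn_sym; apply: conn_trans (conn_trans se _); rewrite conn_sym.
Qed.

Lemma spans_sub A B e : A \subset B -> spans A e -> spans B e.
Proof. exact: conn_sub. Qed.

Lemma spans_closed A B e : (forall g, g \in A -> spans B g) -> spans A e -> spans B e.
Proof. exact: conn_closed. Qed.

Lemma minimal_spanning A e : spans A e ->
  exists2 B : {set edg G}, B \subset A & spans B e /\ forall g, g \in B -> ~~ spans (B :\ g) e.
Proof.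
move=> sA; pose P B := spans B e.
have [B /minsetP[sB mB] BA] := minset_exists (P := P) sA.
exists B => //; split=> // g gB; apply/negP => h.
by have /setP/(_ g) := mB _ h (subD1set _ _); rewrite !inE eqxx gB.
Qed.

(** * Bases and exchange *)

Definition indep A := [forall e in A, ~~ spans (A :\ e) e].
Definition basis A := [forall e, spans A e] && indep A.

Lemma basisP A :
  reflect ((forall e, spans A e) /\ (forall e, e \in A -> ~~ spans (A :\ e) e)) (basis A).
Proof. by apply: (iffP andP) => -[] /forallP h /'forall_implyP k. Qed.

Lemma basis_exchange S e f :
  basis S -> e \in S -> ~~ spans (S :\ e) f -> basis (f |: S :\ e).
Proof.
move=> /basisP[sS iS] eS nf.
have fS : f \notin S :\ e by apply: contra nf => /mem_spans.
apply/basisP; split.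
  move=> g; apply: spans_closed (sS g) => h hS.
  have [->|he] := eqVneq h e; last by apply/mem_spans; rewrite !inE he hS orbT.
  by apply: spans_exchange nf; rewrite setD1K.
move=> g /setU1P[->|gS]; first by rewrite setU1K.
apply/negP => h; have gf : g != f by apply: contraNneq fS => <-.
have E : (f |: S :\ e) :\ g = f |: (S :\ e :\ g).
  by apply/setP=> x; rewrite !inE; case: (eqVneq x f) => // ->; rewrite eq_sym gf.
move: gS; rewrite !inE => /andP[ge gS].
rewrite E in h; move/spans_exchange: h; rewrite setD1K ?inE ?ge // => h.
case/negP: nf; apply: h; apply: contra (iS g gS).
by apply: spans_sub; apply: setSD; apply: subD1set.
Qed.

(** Steinitz exchange: swapping some [a] of [S :\: T] for a [b] of [T] outside the span of [S :\ a]
    keeps the size of [S] and shrinks the difference. *)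
Lemma leq_card_basis S T : basis S -> basis T -> #|S| <= #|T|.
Proof.
move En: #|S :\: T| => n; elim: n S En => [|n IH] S En bS bT.
  by apply: subset_leq_card; rewrite -setD_eq0 -cards_eq0 En.
have /card_gt0P[a] : 0 < #|S :\: T| by rewrite En.
rewrite inE => /andP[aT aS].
have nsa : ~~ spans (S :\ a) a by case/basisP: (bS) => _; apply.
have [b bB nb] : exists2 b, b \in T & ~~ spans (S :\ a) b.
  apply/exists_inP; rewrite -negb_forall_in; apply: contra nsa => /'forall_implyP h.
  by case/basisP: bT => + _; move/(_ a); apply: spans_closed.
have bS' : b \notin S :\ a by apply: contra nb => /mem_spans.
have -> : #|S| = #|b |: S :\ a| by rewrite (cardsD1 a S) aS cardsU1 bS'.
apply: IH => //; last exact: basis_exchange.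
have -> : (b |: S :\ a) :\: T = (S :\: T) :\ a.
  apply/setP => x; rewrite !inE; case: (eqVneq x b) => [->|_] /=.
    by rewrite bB andbF.
  by case: (x \in T) => //=; rewrite andbF.
by have := cardsD1 a (S :\: T); rewrite En inE aT aS => -[].
Qed.

Lemma eq_card_basis S T : basis S -> basis T -> #|S| = #|T|.
Proof. by move=> bS bT; apply/eqP; rewrite eqn_leq !leq_card_basis. Qed.

(** For a basis [S] this has two readings: [g] lies in the fundamental cut of [e], and [e] lies on
    the path of [S] between the ends of [g]. *)
Definition crosses S e g := (e \in S) && ~~ spans (S :\ e) g.

Lemma spans_basisD1 S d : basis S -> spans (S :\ d) d = (d \notin S).
Proof.
case/basisP => sS iS; case dS: (d \in S); first exact/negbTE/iS.
have -> : S :\ d = S; last exact: sS.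
by apply/setP => x; rewrite !inE; case: eqP => // ->.
Qed.

Lemma basis_crosses S e : basis S -> crosses S e e = (e \in S).
Proof. by case/basisP => _ h; rewrite /crosses; case: (boolP (e \in S)) => // /h. Qed.

(** Some edge [g] of the path of [T] between the ends of [e] must leave the span of [S :\ e]. If
    [T :\ g] still spanned [e], then [e] and the rest of the path would make it span [g]. *)
Lemma symmetric_exchange S T e : basis S -> basis T -> e \in S ->
  exists g, crosses S e g && crosses T g e.
Proof.
move=> /basisP[sS iS] /basisP[sT iT] eS; rewrite /crosses eS /=.
have [B BT [sB mB]] := minimal_spanning (sT e).
have [g gB ng] : exists2 g, g \in B & ~~ spans (S :\ e) g.
  apply/exists_inP; rewrite -negb_forall_in; apply: contra (iS e eS) => /'forall_implyP h.
  exact: spans_closed sB.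
have gT := subsetP BT g gB; exists g; rewrite ng gT /=.
apply: contra (iT g gT) => h.
have: spans (e |: B :\ g) g.
  by apply: spans_exchange (mB g gB); rewrite setD1K.
apply: spans_closed => x /setU1P[->//|xB]; apply: mem_spans.
by move: x xB; apply/subsetP/setSD.
Qed.

(** * Cycles defined by vertex degrees *)

Lemma degU1 C e x : e \notin C ->
  deg (e |: C) x = ((ends e).1 == x) + ((ends e).2 == x) + deg C x.
Proof. by move=> eC; rewrite /deg big_setU1. Qed.

(* Otherwise one end of e would be the only vertex of odd degree of C - e in
   its component. *)
Lemma cycle_spans C e : is_cycle C -> e \in C -> spans (C :\ e) e.
Proof.
move=> /and3P[_ /forallP dC _] eC; apply/negPn/negP => nv.
pose K := [pred x | conn (C :\ e) (ends e).1 x].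
have cnt (y : vtx G) : \sum_(x in K) (y == x) = (y \in K).
  case yK: (y \in K).
    by rewrite (bigD1 y) //= eqxx big1 // => x /andP[_]; rewrite eq_sym => /negPf->.
  by rewrite big1 // => x xK; case: eqVneq => // yx; rewrite yx xK in yK.
have ev : ~~ odd (\sum_(x in K) deg C x).
  elim/big_rec: _ => // x n _ IH; rewrite oddD (negPf IH) addbF.
  by case/orP: (dC x) => /eqP ->.
have ev' : ~~ odd (\sum_(x in K) deg (C :\ e) x).
  rewrite /deg exchange_big /=; elim/big_rec: _ => // g n gC IH.
  rewrite oddD (negPf IH) addbF big_split /=.
  rewrite !cnt !inE; suff -> : conn (C :\ e) (ends e).1 (ends g).1 = conn (C :\ e) (ends e).1 (ends g).2.
    by rewrite addnn odd_double.
  have gs : spans (C :\ e) g by exact: mem_spans.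
  by apply/idP/idP => /conn_trans; apply; rewrite // conn_sym.
case/negP: ev; have -> : \sum_(x in K) deg C x = 1 + \sum_(x in K) deg (C :\ e) x.
  rewrite -[in LHS](setD1K eC); under eq_bigr do rewrite degU1 ?setD11 //.
  by rewrite !big_split /= !cnt !inE conn_refl -/(spans _ _) (negPf nv).
by rewrite oddD (negPf ev').
Qed.

(** The two correction terms let one degree equation cover inner vertices, both ends, and the
    one-vertex path, where they coincide. *)
Lemma path_degrees A u p : path (link A) u p -> uniq (u :: p) ->
  exists2 C : {set edg G}, C \subset A &
    (forall x, deg C x + (u == x) + (last u p == x) = (x \in u :: p).*2) /\
    (forall x, x \in u :: p -> conn C u x).
Proof.
elim: p u => [|w p IH] u /=.
  move=> _ _; exists set0; first exact: sub0set.
  split=> x; last by rewrite inE => /eqP ->; apply: conn_refl.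
  by rewrite /deg big_set0 inE eq_sym addnn.
move=> /andP[/linkP[e eA Ee] /IH{}IH] /andP[un /IH{IH}[C CA [dC cC]]].
have eC : e \notin C.
  apply/negP => eC; have := dC u; rewrite (negPf un) /deg (big_setD1 _ eC) /=.
  by case: Ee => -> /=; rewrite eqxx ?addn1.
have d x : deg (e |: C) x = (u == x) + (w == x) + deg C x.
  by rewrite degU1 //; case: Ee => -> //=; rewrite [X in X + _]addnC.
exists (e |: C); first by rewrite subUset sub1set eA.
split=> x.
  rewrite d -addnA -addnA [_ + (last _ _ == _)]addnC.
  have := dC x; rewrite [x \in u :: _]inE (eq_sym x u); case: (eqVneq u x) => [<-|_] /=.
    rewrite (negPf un) => /eqP; rewrite !addn_eq0 => /andP[/andP[/eqP-> /eqP->] /eqP->].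
    by [].
  by move=> <-; rewrite !add0n !addn0 addnCA addnA addnC.
have cw : conn (e |: C) u w.
  by apply/connect1/linkP; exists e; rewrite ?setU11.
rewrite inE => /predU1P[->|/cC h]; first exact: conn_refl.
by apply: conn_trans cw (conn_sub _ h); apply: subsetU1.
Qed.

(** Adding [e] to a simple path supplies exactly the two correction terms of [path_degrees], so all
    degrees become zero or two. *)
Lemma spans_cycle A e : e \notin A -> spans A e ->
  exists2 C, is_cycle C & C \subset e |: A.
Proof.
move=> eA /connectP[p0 pp0 lp0].
move: lp0; case: (shortenP pp0) => p pp un _ Lp {p0 pp0}.
have [C CA [dC cC]] := path_degrees pp un; rewrite -Lp in dC.
have eC : e \notin C by apply: contra eA => /(subsetP CA).
have d x : deg (e |: C) x = (x \in (ends e).1 :: p).*2 by rewrite degU1 // -dC addnC addnA.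
exists (e |: C); last exact: setUS.
apply/and3P; split.
- by apply/set0Pn; exists e; rewrite setU11.
- by apply/forallP => v; rewrite d; case: (_ \in _).
apply/forallP => u; apply/forallP => v; apply/implyP; rewrite !d.
rewrite -!lt0n !double_gt0 !lt0b => /andP[/cC h /cC k].
by apply: conn_sub (subsetU1 _ _) _; apply: conn_trans k; rewrite conn_sym.
Qed.

Lemma acyclic_indep A : acyclic A = indep A.
Proof.
apply/'forall_implyP/'forall_implyP => [h e eA|h C CA].
  apply/negP => /spans_cycle []; first by rewrite setD11.
  by move=> C cC; rewrite setD1K // => /h; rewrite cC.
apply/negP => cC; case/and3P: (cC) => /set0Pn[e eC] _ _.
case/negP: (h e (subsetP CA e eC)).
by apply: spans_sub (cycle_spans cC eC); apply: setSD.
Qed.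

(** [Ccyc] picks an arbitrary cycle in [e |: T]; the description by [crosses] shows that its edges
    do not depend on the choice. *)
Lemma mem_Ccyc T e g : basis T -> e \notin T ->
  (g \in Ccyc T e) = (g == e) || crosses T g e.
Proof.
move=> /basisP[sT iT] eT; rewrite /Ccyc.
(* The default [set0] never occurs, as [spans_cycle] supplies a cycle. *)
case: pickP => /= [C /andP[cC CT]|]; last first.
  by have [C cC CT] := spans_cycle eT (sT e) => /(_ C); rewrite cC CT.
have eC : e \in C.
  apply/negPn/negP => eC; have {}CT : C \subset T.
    apply/subsetP => x xC; have /setU1P[xe|//] := subsetP CT x xC.
    by rewrite -xe xC in eC.
  have := acyclic_indep T; have -> : indep T by apply/'forall_implyP.
  by move/'forall_implyP/(_ C CT); rewrite cC.
rewrite /crosses; case: (eqVneq g e) => [->//|ge] /=.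
apply/idP/andP => [gC|[gT]].
  have gT : g \in T by have := subsetP CT g gC; rewrite !inE (negPf ge).
  split=> //; apply: contra (iT g gT) => h.
  apply: spans_closed (cycle_spans cC gC) => x; rewrite !inE => /andP[xg /(subsetP CT)].
  by case/setU1P => [->//|xT]; apply: mem_spans; rewrite !inE xg.
apply: contraR => gC; apply: spans_sub (cycle_spans cC eC).
apply/subsetP => x; rewrite !inE => /andP[xe xC].
have := subsetP CT x xC; rewrite !inE (negPf xe) /= => ->; rewrite andbT.
by apply: contraNneq gC => <-.
Qed.

(** * Unique exchanges in matroid terms *)

Definition exchangeable S T e g := crosses S e g && crosses T g e.

Definition uniquely_exchangeable S T e f :=
  [forall g, exchangeable S T e g == (g == f)].

(** The intersection of cut and cycle is [e] together with all exchange partners of [e];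
    disjointness keeps [e] from being its own partner. *)
Lemma uexS_exchange S T e f : basis S -> basis T -> [disjoint S & T] ->
  uexS S T e f = uniquely_exchangeable S T e f.
Proof.
move=> bS bT dST; case/basisP: (bS) => _ iS.
have D x : x \in S -> x \in T = false by exact: disjointFr.
case eS: (e \in S); last first.
  rewrite /uexS eS; apply/esym/negP => /forallP/(_ f).
  by rewrite /exchangeable /crosses eS eqxx.
have key g : (g \in Dcut S e :&: Ccyc T e) = (g == e) || exchangeable S T e g.
  rewrite !inE mem_Ccyc ?D // /exchangeable /crosses eS /=.
  by case: (eqVneq g e) => // ->; rewrite -/(spans _ _) iS.
have nee : exchangeable S T e e = false by rewrite /exchangeable /crosses (D e) ?andbF.
rewrite /uexS eS /=; apply/andP/forallP => [[fT /eqP E] g|h].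
  have := key g; rewrite E !inE; case: (eqVneq g e) => [->|_] /=; last by move=> ->.
  by move=> _; rewrite nee; case: (eqVneq e f) => // ef; rewrite -ef D in fT.
split; first by have /eqP := h f; rewrite eqxx => /andP[_ /andP[]].
by apply/eqP/setP => g; rewrite key (eqP (h g)) !inE.
Qed.

Hypothesis conG : forall u v, conn [set: edg G] u v.

Lemma spanning_tree_basis T : spanning_tree T = basis T.
Proof.
rewrite /spanning_tree /spanning_tree_on subsetT acyclic_indep /basis /=.
congr (_ && _); apply/forallP/forallP => [h e|h u].
  have /implyP/(_ (in_setT _))/'forall_implyP := h (ends e).1.
  by apply; rewrite inE.
apply/implyP => _; apply/'forall_implyP => v _.
by apply: conn_closed (conG u v) => e _; apply: h.
Qed.

End GraphicMatroid.

(** * Pairs of disjoint spanning trees *)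

Section TauVertices.
Variable G : graph.
Implicit Types (S T : {set edg G}) (p : {set edg G} * {set edg G}) (e f : edg G).
Hypothesis conG : forall u v : vtx G, conn [set: edg G] u v.

Lemma tau_vertexP p :
  reflect [/\ basis p.1, basis p.2 & forall e, (e \in p.2) = (e \notin p.1)] (tau_vertex p).
Proof.
rewrite /tau_vertex !spanning_tree_basis //.
apply: (iffP and4P) => [[b1 b2 d /eqP/setP u]|[b1 b2 c]]; split=> //.
- move=> e; have := u e; rewrite !inE; case E: (e \in p.1); last by move=> /= ->.
  by rewrite (disjointFr d E).
- by rewrite disjoint_subset; apply/subsetP => e ep; rewrite !inE c ep.
- by apply/eqP/setP => e; rewrite !inE c orbN.
Qed.

(** [uexT S T] is [uexS T S] by conversion, so one relation used in both orders covers both kinds of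
    exchange. *)
Lemma tau_arcE e f p : tau_vertex p ->
  tau_arc (e, f, p) =
  uniquely_exchangeable p.1 p.2 e f || uniquely_exchangeable p.2 p.1 e f.
Proof.
move=> vp; rewrite /tau_arc vp; case/tau_vertexP: vp => b1 b2 c.
have d : [disjoint p.1 & p.2].
  by rewrite disjoint_subset; apply/subsetP => x xp; rewrite !inE c xp.
by rewrite uexS_exchange // -[uexT _ _ _ _]/(uexS p.2 p.1 e f) uexS_exchange // disjoint_sym.
Qed.

Lemma uniquely_exchangeable_crosses S T e f :
  uniquely_exchangeable S T e f -> crosses S e f /\ crosses T f e.
Proof. by move/forallP/(_ f); rewrite eqxx => /eqP/andP. Qed.

Lemma uniquely_exchangeable_mem S T e f :
  uniquely_exchangeable S T e f -> e \in S /\ f \in T.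
Proof. by case/uniquely_exchangeable_crosses => /andP[-> _] /andP[-> _]. Qed.

Lemma exchange_basis S T e f : basis S -> basis T -> (forall x, (x \in T) = (x \notin S)) ->
  uniquely_exchangeable S T e f ->
  [/\ basis ((S :\ e) :|: [set f]), basis ((T :|: [set e]) :\ f) &
      forall x, (x \in (T :|: [set e]) :\ f) = (x \notin (S :\ e) :|: [set f])].
Proof.
move=> bS bT c /uniquely_exchangeable_crosses[/andP[eS nf] /andP[fT ne]].
have ef : e != f by apply: contraTneq fT => <-; rewrite c eS.
split.
- by rewrite setUC; apply: basis_exchange.
- have -> : (T :|: [set e]) :\ f = e |: T :\ f; last exact: basis_exchange.
  by apply/setP => x; rewrite !inE; case: (eqVneq x e) => [->|_]; rewrite ?ef ?orbF ?orbT.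
- move=> x; rewrite !inE c; case: (eqVneq x f) => [|_]; first by rewrite orbT.
  by rewrite orbF; case: (x == e); rewrite ?orbT ?orbF.
Qed.

Lemma tau_head_vertex e f p : tau_arc (e, f, p) -> tau_vertex (tau_head (e, f, p)).
Proof.
move=> a; have vp : tau_vertex p by case/andP: a.
case/tau_vertexP: (vp) => b1 b2 c; move: a; rewrite tau_arcE // /tau_head.
case/orP => h; have [eS fT] := uniquely_exchangeable_mem h.
  by rewrite eS; apply/tau_vertexP; apply: exchange_basis.
move: eS; rewrite c => /negPf ->.
have c' x : (x \in p.1) = (x \notin p.2) by rewrite c negbK.
have [h1 h2 h3] := exchange_basis b2 b1 c' h.
by apply/tau_vertexP; split=> // x; rewrite [_.2]/= [_.1]/= h3 negbK.
Qed.

End TauVertices.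

Lemma card_sum_mem (E : finType) (A : {set E}) : #|A| = \sum_e (e \in A).
Proof. by rewrite -sum1_card big_mkcond; apply: eq_bigr => e _; case: (e \in A). Qed.

(** * Consequences of having two complementary trees *)

Section Bispanning.
Variable G : graph.
Implicit Types (S T : {set edg G}) (p : {set edg G} * {set edg G}) (e f : edg G).

Lemma bispanning_tau : bispanning G -> exists p, @tau_vertex G p.
Proof. by case/existsP => S /existsP[T h]; exists (S, T). Qed.

Lemma tau_vertex_conn p : tau_vertex p -> forall u v : vtx G, conn [set: edg G] u v.
Proof.
case/and4P => /and3P[_ /forallP h _] _ _ _ u v.
have /implyP/(_ (in_setT _))/'forall_implyP/(_ v (in_setT _)) := h u.
exact/conn_sub/subsetT.
Qed.

Lemma bispanning_conn : bispanning G -> forall u v : vtx G, conn [set: edg G] u v.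
Proof. by case/bispanning_tau => p; apply: tau_vertex_conn. Qed.

(** Exactly one tree of the pair contains [d]: its independence shows that [d] is no loop, and the
    other tree joins the ends without [d]. *)
Lemma tau_vertex_nonloop p (d : edg G) : tau_vertex p -> ~~ spans set0 d /\ spans [set~ d] d.
Proof.
move=> vp; case/(tau_vertexP (tau_vertex_conn vp)): vp => b1 b2 c.
have key S T : basis S -> basis T -> d \in S -> d \notin T ->
    ~~ spans set0 d /\ spans [set~ d] d.
  move=> /basisP[_ iS] /basisP[sT _] dS dT; split.
    by apply: contra (iS d dS); apply/spans_sub/sub0set.
  apply: spans_sub (sT d); apply/subsetP => x xT; rewrite !inE.
  by apply: contraNneq dT => <-.
case dS: (d \in p.1); first by apply: (key _ _ b1 b2); rewrite // c dS.
by apply: (key _ _ b2 b1); rewrite ?c ?dS.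
Qed.

(** The sizes of [S] and [T] have the same sum as those of the pair [p]; every other edge counts
    once in both sums, hence so does [d]. *)
Lemma complement_at p S T (d : edg G) : tau_vertex p -> basis S -> basis T ->
  (forall e, e != d -> (e \in T) = (e \notin S)) -> (d \in T) = (d \notin S).
Proof.
move=> vp; case/(tau_vertexP (tau_vertex_conn vp)): vp => b1 b2 c bS bT h.
have := congr2 addn (eq_card_basis bS b1) (eq_card_basis bT b2).
rewrite !card_sum_mem -!big_split /= (bigD1 d) //= [RHS](bigD1 d) //=.
have E : \sum_(e | e != d) ((e \in S) + (e \in T)) =
         \sum_(e | e != d) ((e \in p.1) + (e \in p.2)).
  by apply: eq_bigr => e ed; rewrite h // c; do 2!case: (_ \in _).
rewrite E => /addIn; rewrite c.
by case: (d \in p.1); case: (d \in S); case: (d \in T).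
Qed.

Lemma tau_vertex_inj p p' : tau_vertex p -> tau_vertex p' -> p.1 = p'.1 -> p = p'.
Proof.
move=> vp vp'; have cG := tau_vertex_conn vp.
case/(tau_vertexP cG): vp => _ _ c; case/(tau_vertexP cG): vp' => _ _ c' E.
rewrite (surjective_pairing p) (surjective_pairing p') E; congr pair.
by apply/setP => e; rewrite c c' E.
Qed.

Lemma tau_arc_mem e f p : tau_arc (e, f, p) -> (f \in p.1) = (e \notin p.1).
Proof.
move=> a; have vp : tau_vertex p by case/andP: a.
move: a; have cG := tau_vertex_conn vp; rewrite tau_arcE //.
case/(tau_vertexP cG): vp => _ _ c.
by case/orP => /uniquely_exchangeable_mem[]; rewrite c; do 2!case: (_ \in _).
Qed.

(** Both forms of the head toggle [e] and [f] in the first tree, which removes the case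
    distinction. *)
Lemma mem_tau_head e f p x : tau_arc (e, f, p) ->
  (x \in (tau_head (e, f, p)).1) = (x \in p.1) (+) ((x == e) || (x == f)).
Proof.
move=> /tau_arc_mem fS; have ef : f != e by apply/eqP => E; move: fS; rewrite E; case: (_ \in _).
rewrite /tau_head; case eS: (e \in p.1) fS => /= fS; rewrite !inE;
  case: (eqVneq x e) => [->|_]; rewrite ?eS ?[e == f]eq_sym ?(negPf ef) ?orbT //=;
  by case: (eqVneq x f) => [->|_]; rewrite ?fS ?orbF ?orbT ?addbF.
Qed.

End Bispanning.

(** * Connectivity and bases in a clique sum *)

Definition res (E E' : finType) (d : E') (j : {e : E' | e != d} -> E) (A : {set E}) : {set E'} :=
  [set val x | x in j @^-1: A].

Lemma mem_res (E E' : finType) (d : E') (j : {e : E' | e != d} -> E) A x :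
  (val x \in res j A) = (j x \in A).
Proof. by rewrite mem_imset ?inE //; apply: val_inj. Qed.

Lemma notin_res (E E' : finType) (d : E') (j : {e : E' | e != d} -> E) A : d \notin res j A.
Proof. by apply/imsetP => -[x _ dx]; have := valP x; rewrite -dx eqxx. Qed.

(** The boolean index names corresponding ends of [d1] and [d2], the ones that get identified. *)
Definition terminal (G : graph) (d : edg G) (k : bool) := if k then (ends d).1 else (ends d).2.

(* The 2-clique sum without a fixed edge type, so that the roles of the two
   summands can be exchanged. *)
Record glued (G G1 G2 : graph) (d1 : edg G1) (d2 : edg G2)
    (i1 : vtx G1 -> vtx G) (i2 : vtx G2 -> vtx G)
    (j1 : {e : edg G1 | e != d1} -> edg G) (j2 : {e : edg G2 | e != d2} -> edg G) : Prop :=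
  Glued {
    glued_inj1 : injective i1; glued_inj2 : injective i2;
    glued_terminal : forall x y, i1 x = i2 y <-> exists k, x = terminal d1 k /\ y = terminal d2 k;
    glued_ends1 : forall x, ends (j1 x) = (i1 (ends (val x)).1, i1 (ends (val x)).2);
    glued_ends2 : forall x, ends (j2 x) = (i2 (ends (val x)).1, i2 (ends (val x)).2);
    glued_injE1 : injective j1; glued_injE2 : injective j2;
    glued_disj : forall x y, j1 x <> j2 y;
    glued_cover : forall e, (exists x, e = j1 x) \/ (exists y, e = j2 y) }.

Lemma gluedC G G1 G2 (d1 : edg G1) (d2 : edg G2) (i1 : vtx G1 -> vtx G) i2 j1 j2 :
  @glued G G1 G2 d1 d2 i1 i2 j1 j2 -> glued i2 i1 j2 j1.
Proof.
case=> a b t e1 e2 c d n cv; split=> //.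
- by move=> x y; split=> [/esym/t|] [k [h1 h2]]; [exists k | apply/esym/t; exists k].
- by move=> x y /esym; apply: n.
- by move=> e; case: (cv e); auto.
Qed.

Lemma conn_terminal (G : graph) (A : {set edg G}) d k k' :
  spans A d -> conn A (terminal d k) (terminal d k').
Proof. by case: k k' => -[] // h; rewrite ?conn_refl // conn_sym. Qed.

Lemma conn_res G G1 G2 (d1 : edg G1) (d2 : edg G2) (i1 : vtx G1 -> vtx G) i2 j1 j2 A a b :
  @glued G G1 G2 d1 d2 i1 i2 j1 j2 -> conn (res j1 A) a b -> conn A (i1 a) (i1 b).
Proof.
move=> gl c; apply: (conn_ind (P := fun b => conn A (i1 a) (i1 b)) _ c); last exact: conn_refl.
move=> _ /imsetP[x + ->]; rewrite inE => /mem_spans; rewrite /spans (glued_ends1 gl) /= => h.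
by split=> /conn_trans; apply; rewrite // conn_sym.
Qed.

Definition adjoin (E : finType) (d : E) (b : bool) (A : {set E}) := if b then d |: A else A.

Lemma sub_adjoin (E : finType) (d : E) b (A : {set E}) : A \subset adjoin d b A.
Proof. by case: b => //=; apply: subsetU1. Qed.

(** * Connectivity across the gluing *)

Section Glued.
Variables (G G1 G2 : graph) (d1 : edg G1) (d2 : edg G2).
Variables (i1 : vtx G1 -> vtx G) (i2 : vtx G2 -> vtx G).
Variables (j1 : {e : edg G1 | e != d1} -> edg G) (j2 : {e : edg G2 | e != d2} -> edg G).
Hypothesis gl : glued i1 i2 j1 j2.

Lemma conn_glued A a b :
  conn A (i1 a) (i1 b) = conn (adjoin d1 (spans (res j2 A) d2) (res j1 A)) a b.
Proof.
set c := spans (res j2 A) d2; set B := adjoin d1 c (res j1 A).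
apply/idP/idP => h; last first.
  apply: (conn_ind (P := fun b => conn A (i1 a) (i1 b)) _ h); last exact: conn_refl.
  move=> e eB; suff ce : conn A (i1 (ends e).1) (i1 (ends e).2).
    by split=> /conn_trans; apply; rewrite // conn_sym.
  have [er|er] := boolP (e \in res j1 A); first exact: conn_res gl (mem_spans er).
  have [ed cT] : e = d1 /\ c.
    by move: eB; rewrite /B /adjoin; case: (c); rewrite ?inE (negPf er) // orbF => /eqP.
  rewrite {}ed; have E k : i1 (terminal d1 k) = i2 (terminal d2 k).
    by apply/(glued_terminal gl); exists k.
  by rewrite (E true) (E false); apply: conn_res (gluedC gl) cT.
(* To reach [y] on the second side from [a]: first reach a shared vertex inside [B], then continue
   within the second trace. *)
pose Q y := exists k, conn B a (terminal d1 k) /\ conn (res j2 A) (terminal d2 k) y.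
(* A shared vertex has a preimage on each side; [P1] and [P2] check that both conditions agree
   there. *)
pose P w := (forall x, w = i1 x -> conn B a x) /\ (forall y, w = i2 y -> Q y).
have P1 x : P (i1 x) <-> conn B a x.
  split=> [[h1 _]|h1]; first exact: h1.
  split=> [x' /(glued_inj1 gl) <- //|y /(glued_terminal gl)[k [Ex ->]]].
  by exists k; rewrite -Ex conn_refl.
have P2 y : P (i2 y) <-> Q y.
  split=> [[_ h1]|h1]; first exact: h1.
  split=> [x|y' /(glued_inj2 gl) <- //] /esym/(glued_terminal gl)[k [-> Ey]].
  case: h1 => k' [h1]; rewrite Ey => h2; apply: conn_trans h1 _.
  (* Two different shared vertices can occur here only if the second side joins them, and then [d1]
     is in [B]. *)
  case: (eqVneq k k') => [->|nk]; first exact: conn_refl.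
  have cT : c.
    by move: h2 nk; case: k k' {Ey} => -[] //= h2 _; rewrite /c /spans // conn_sym.
  by apply: conn_terminal; apply: mem_spans; rewrite /B cT setU11.
suff: P (i1 b) by move/P1.
apply: (conn_ind _ h); last by apply/P1; apply: conn_refl.
move=> e eA; have [[x Ex]|[y Ey]] := glued_cover gl e.
  rewrite Ex (glued_ends1 gl) /=.
  have /mem_spans hx : val x \in B by apply: (subsetP (sub_adjoin _ _ _)); rewrite mem_res -Ex.
  by split=> /P1 h1; apply/P1; apply: conn_trans h1 _; rewrite // conn_sym.
rewrite Ey (glued_ends2 gl) /=.
have /mem_spans hy : val y \in res j2 A by rewrite mem_res -Ey.
by split=> /P2[k [h1 h2]]; apply/P2; exists k; split=> //; apply: conn_trans h2 _; rewrite // conn_sym.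
Qed.

Lemma spans_glued A x :
  spans A (j1 x) = spans (adjoin d1 (spans (res j2 A) d2) (res j1 A)) (val x).
Proof. by rewrite {1}/spans (glued_ends1 gl) conn_glued. Qed.

Lemma res_setD1 A x : res j1 (A :\ j1 x) = res j1 A :\ val x.
Proof.
apply/setP => e; rewrite !inE; case: (eqVneq e d1) => [->|ed].
  by rewrite (negPf (notin_res _ _)) (negPf (notin_res _ _)) andbF.
by rewrite -(SubK [the subType _ of {e | e != d1}] ed) !mem_res !inE (inj_eq (glued_injE1 gl)).
Qed.

Lemma glued_neq x y : (j1 x == j2 y) = false.
Proof. by apply/eqP; apply: glued_disj gl x y. Qed.

Lemma res_setD1_other A y : res j1 (A :\ j2 y) = res j1 A.
Proof.
apply/setP => e; case: (eqVneq e d1) => [->|ed].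
  by rewrite (negPf (notin_res _ _)) (negPf (notin_res _ _)).
rewrite -(SubK [the subType _ of {e | e != d1}] ed) !mem_res !inE.
by rewrite glued_neq.
Qed.

End Glued.

Lemma adjoin_setD1 (E : finType) (d : E) (A : {set E}) : adjoin d (d \in A) (A :\ d) = A.
Proof.
apply/setP => x; rewrite /adjoin; case dA: (d \in A); rewrite !inE.
  by case: eqVneq => // ->.
by case: eqVneq => // ->.
Qed.

Lemma adjoin_setD1C (E : finType) (d x : E) b (A : {set E}) :
  x != d -> adjoin d b (A :\ x) = adjoin d b A :\ x.
Proof.
move=> xd; case: b => //=; apply/setP => y; rewrite !inE.
by case: (eqVneq y d) => // ->; rewrite eq_sym xd.
Qed.

(** * Spanning trees of the sum and of the summands *)

Section Split.
Variables (G G1 G2 : graph) (d1 : edg G1) (d2 : edg G2).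
Variables (i1 : vtx G1 -> vtx G) (i2 : vtx G2 -> vtx G).
Variables (j1 : {e : edg G1 | e != d1} -> edg G) (j2 : {e : edg G2 | e != d2} -> edg G).

(** The balance clause says that exactly one of the two trees uses its virtual edge, namely the one
    whose own side leaves the shared vertices apart. *)
Definition splits S S1 S2 :=
  [/\ basis S1, basis S2, (d1 \in S1) = (d2 \notin S2),
      res j1 S = S1 :\ d1 & res j2 S = S2 :\ d2].

Hypothesis gl : glued i1 i2 j1 j2.

Lemma mem_splits S S1 S2 x : splits S S1 S2 -> (j1 x \in S) = (val x \in S1).
Proof. by case=> _ _ _ E _; rewrite -mem_res E !inE (valP x). Qed.

(** Removing [j1 x] leaves the second trace alone. It joins the shared vertices exactly when
    [d1 \in S1], so adjoining gives back [S1 :\ val x]. *)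
Lemma crosses_same S S1 S2 x y :
  splits S S1 S2 -> crosses S (j1 x) (j1 y) = crosses S1 (val x) (val y).
Proof.
move=> sp; rewrite /crosses (mem_splits _ sp); case: sp => b1 b2 bal r1 r2.
rewrite (spans_glued gl) (res_setD1 gl) (res_setD1_other (gluedC gl)) r1 r2.
by rewrite spans_basisD1 // -bal adjoin_setD1C ?(valP x) // adjoin_setD1.
Qed.

(** [j1 x] affects [j2 y] only through the shared vertices: its removal must separate them, and [y]
    must need that connection, which [d2] represents in [S2]. *)
Lemma crosses_diff S S1 S2 x y :
  splits S S1 S2 -> crosses S (j1 x) (j2 y) = crosses S1 (val x) d1 && crosses S2 d2 (val y).
Proof.
move=> sp; rewrite /crosses (mem_splits _ sp); case: sp => b1 b2 bal r1 r2.
rewrite (spans_glued (gluedC gl)) (res_setD1 gl) (res_setD1_other (gluedC gl)) r1 r2.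
case: (val x \in S1) => //=; case/basisP: (b2) => s2 _.
case d2S: (d2 \in S2) bal => /= bal; last first.
  rewrite andbF; apply/negbF; apply: spans_sub (sub_adjoin _ _ _) _.
  by have := adjoin_setD1 d2 S2; rewrite d2S /= => ->.
have -> : S1 :\ d1 :\ val x = S1 :\ val x.
  by have := adjoin_setD1 d1 S1; rewrite bal /= => ->.
case: (spans _ d1) => //=; apply/negbF.
by rewrite setD1K.
Qed.

Lemma spans_splits S S1 S2 x : splits S S1 S2 -> spans S (j1 x).
Proof.
case=> b1 b2 bal r1 r2; rewrite (spans_glued gl) r1 r2 spans_basisD1 // -bal adjoin_setD1.
by case/basisP: b1.
Qed.

(** If neither side joined the shared vertices, the first trace would span every edge but [d1],
    hence also [d1]. If both did, an edge of the connecting path on the first side would be spanned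
    by the rest of [S] through the second side. *)
Lemma restrict_basis_xor S : basis S -> ~~ spans set0 d1 -> spans [set~ d1] d1 ->
  spans (res j2 S) d2 = ~~ spans (res j1 S) d1.
Proof.
move=> /basisP[sS iS] nl ncl; apply/idP/idP => [c2|]; last first.
  apply: contraR => nc2; apply: spans_closed ncl => e; rewrite !inE => ed.
  by have := sS (j1 (Sub e ed)); rewrite (spans_glued gl) (negPf nc2).
apply/negP => /minimal_spanning[B BS [sB mB]].
have /set0Pn[e eB] : B != set0 by apply: contraNneq nl => <-.
have /imsetP[x + Ex] := subsetP BS e eB; rewrite inE => xS.
case/negP: (iS _ xS); rewrite (spans_glued gl) (res_setD1_other (gluedC gl)) c2.
rewrite (res_setD1 gl).
have: spans (d1 |: B :\ e) e by apply: spans_exchange (mB e eB); rewrite setD1K.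
by rewrite -Ex; apply: spans_sub; apply: setUS; apply: setSD.
Qed.

Definition completion (S : {set edg G}) := adjoin d1 (~~ spans (res j1 S) d1) (res j1 S).

Lemma mem_completion S x : (val x \in completion S) = (j1 x \in S).
Proof. by rewrite /completion /adjoin; case: ifP; rewrite ?inE ?(negPf (valP x)) mem_res. Qed.

Lemma completion_setD1 S : completion S :\ d1 = res j1 S.
Proof.
rewrite /completion /adjoin; case: ifP => _; first by rewrite setU1K ?notin_res.
by apply/setP => x; rewrite !inE; case: eqP => // ->; rewrite (negPf (notin_res _ _)).
Qed.

Lemma mem_completion_d S : (d1 \in completion S) = ~~ spans (res j1 S) d1.
Proof. by rewrite /completion /adjoin; case: ifP; rewrite ?setU11 ?(negPf (notin_res _ _)). Qed.

(** By the second hypothesis the bit in [completion] tells whether the other side joins the shared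
    vertices, so a real edge is spanned by [S] exactly when the completion spans it. *)
Lemma completion_basis S : basis S -> spans (res j2 S) d2 = ~~ spans (res j1 S) d1 ->
  basis (completion S).
Proof.
move=> /basisP[sS iS] x12; apply/basisP.
have spx (x : {e | e != d1}) : spans (completion S) (val x) by have := sS (j1 x); rewrite (spans_glued gl) x12.
have elim_edge (P : edg G1 -> Prop) : P d1 -> (forall x : {e | e != d1}, P (val x)) -> forall e, P e.
  by move=> h1 h2 e; case: (eqVneq e d1) => [->//|ed]; apply: (h2 (Sub e ed)).
split; apply: elim_edge => //.
- rewrite /completion /adjoin; case: ifP => [_|/negbFE //].
  by apply/mem_spans/setU11.
- by rewrite mem_completion_d completion_setD1.
- move=> x; rewrite mem_completion => /iS; rewrite (spans_glued gl).
  by rewrite (res_setD1_other (gluedC gl)) x12 (res_setD1 gl) adjoin_setD1C ?(valP x).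
Qed.

End Split.

(** * Unique exchanges in the sum *)

Section Exchanges.
Variables (G G1 G2 : graph) (d1 : edg G1) (d2 : edg G2).
Variables (i1 : vtx G1 -> vtx G) (i2 : vtx G2 -> vtx G).
Variables (j1 : {e : edg G1 | e != d1} -> edg G) (j2 : {e : edg G2 | e != d2} -> edg G).
Hypothesis gl : glued i1 i2 j1 j2.

Lemma splitsC S S1 S2 : splits j1 j2 S S1 S2 -> splits j2 j1 S S2 S1.
Proof. by case=> a b c d e; split=> //; rewrite c negbK. Qed.

(** Independence is the diagonal case of [crosses_same]. *)
Lemma splits_basis S S1 S2 : splits j1 j2 S S1 S2 -> basis S.
Proof.
move=> sp; have [b1 b2 _ _ _] := sp.
apply/basisP; split=> e; case: (glued_cover gl e) => -[x ->].
- exact: spans_splits gl _ _ _ _ sp.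
- exact: spans_splits (gluedC gl) _ _ _ _ (splitsC sp).
- have := crosses_same gl x x sp.
  by rewrite (basis_crosses _ b1) -(mem_splits x sp) /crosses => <- /andP[].
- have := crosses_same (gluedC gl) x x (splitsC sp).
  by rewrite (basis_crosses _ b2) -(mem_splits x (splitsC sp)) /crosses => <- /andP[].
Qed.

Variables (S T : {set edg G}) (S1 T1 : {set edg G1}) (S2 T2 : {set edg G2}).
Hypothesis spS : splits j1 j2 S S1 S2.
Hypothesis spT : splits j1 j2 T T1 T2.
Hypothesis disj2 : forall e, (e \in T2) = (e \notin S2).

Lemma exchangeable_same x y :
  exchangeable S T (j1 x) (j1 y) = exchangeable S1 T1 (val x) (val y).
Proof. by rewrite /exchangeable (crosses_same gl _ _ spS) (crosses_same gl _ _ spT). Qed.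

Lemma exchangeable_diff x y :
  exchangeable S T (j1 x) (j2 y) =
  exchangeable S1 T1 (val x) d1 && exchangeable S2 T2 d2 (val y).
Proof.
rewrite /exchangeable (crosses_diff gl _ _ spS) (crosses_diff (gluedC gl) _ _ (splitsC spT)).
by rewrite [X in _ && X]andbC andbACA.
Qed.

Lemma not_exchangeable_d2 : exchangeable S2 T2 d2 d2 = false.
Proof. by rewrite /exchangeable /crosses disj2; case: (d2 \in S2); rewrite ?andbF. Qed.

Lemma exchange_same x y :
  uniquely_exchangeable S T (j1 x) (j1 y) = uniquely_exchangeable S1 T1 (val x) (val y).
Proof.
apply/forallP/forallP => h g.
  case: (eqVneq g d1) => [->|gd]; last first.
    have := h (j1 (Sub g gd)); rewrite exchangeable_same SubK (inj_eq (glued_injE1 gl)).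
    by rewrite -val_eqE SubK.
  (* If [d1] were a partner of [val x], then [d2] would lie in [S2] and have a partner [z] by
     symmetric exchange; [j2 z] would be a second partner of [j1 x]. *)
  rewrite [d1 == _]eq_sym (negPf (valP y)) eqbF_neg; apply/negP => xd.
  have d2S2 : d2 \in S2.
    have [_ _ bal _ _] := spT; case/andP: xd => _ /andP[d1T _].
    by rewrite bal disj2 negbK in d1T.
  have [_ b2 _ _ _] := spS; have [_ c2 _ _ _] := spT.
  have [z ez] := symmetric_exchange b2 c2 d2S2; rewrite -/(exchangeable _ _ _ _) in ez.
  case: (eqVneq z d2) => [zd|zd]; first by rewrite zd not_exchangeable_d2 in ez.
  have := h (j2 (Sub z zd)); rewrite exchangeable_diff xd SubK ez.
  by rewrite (glued_neq (gluedC gl)).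
case: (glued_cover gl g) => -[z ->].
  by rewrite exchangeable_same (inj_eq (glued_injE1 gl)) -val_eqE.
rewrite exchangeable_diff (eqP (h d1)) [d1 == _]eq_sym (negPf (valP y)).
by rewrite (glued_neq (gluedC gl)).
Qed.

(** If [d1] is the only partner of [val x], no partner of [j1 x] lies on the first side, and those
    on the second side are the partners of [d2]. *)
Lemma exchange_diff x y :
  uniquely_exchangeable S T (j1 x) (j2 y) =
  uniquely_exchangeable S1 T1 (val x) d1 && uniquely_exchangeable S2 T2 d2 (val y).
Proof.
apply/forallP/andP => [h|[/forallP h1 /forallP h2] g]; last first.
  case: (glued_cover gl g) => -[z ->].
    rewrite exchangeable_same (eqP (h1 _)) (negPf (valP z)).
    by rewrite (glued_neq gl).
  rewrite exchangeable_diff (eqP (h1 _)) (eqP (h2 _)) eqxx /=.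
  by rewrite (inj_eq (glued_injE2 gl)) -val_eqE.
have := h (j2 y); rewrite exchangeable_diff eqxx => /eqP/andP[xd dy].
split; apply/forallP => g.
  case: (eqVneq g d1) => [->|gd]; first by rewrite xd.
  have := h (j1 (Sub g gd)); rewrite exchangeable_same SubK => /eqP ->.
  by rewrite (glued_neq gl).
case: (eqVneq g d2) => [->|gd].
  by rewrite not_exchangeable_d2 [d2 == _]eq_sym (negPf (valP y)).
have := h (j2 (Sub g gd)); rewrite exchangeable_diff xd SubK andTb => /eqP ->.
by rewrite (inj_eq (glued_injE2 gl)) -val_eqE SubK.
Qed.

End Exchanges.

(** * The isomorphism *)

Local Arguments tau_arc : simpl never.
Local Arguments tau_head : simpl never.

Section CliqueSum.
Variables (G1 G2 : graph) (d1 : edg G1) (d2 : edg G2).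
Variables (V : finType) (i1 : vtx G1 -> V) (i2 : vtx G2 -> V).
Let G := csum d1 d2 i1 i2.
Let j1 (x : {e : edg G1 | e != d1}) : edg G := inl x.
Let j2 (y : {e : edg G2 | e != d2}) : edg G := inr y.

Lemma csum_glued : clique_sum_maps d1 d2 i1 i2 ->
  @glued G G1 G2 d1 d2 i1 i2 j1 j2.
Proof.
case=> inj1 inj2 t c; split=> //.
- move=> x y; split=> [/t|[k [-> ->]]]; last by apply/t; case: k; auto.
  by case=> -[-> ->]; [exists true|exists false].
- by move=> x y [].
- by move=> x y [].
- by case=> x; [left|right]; exists x.
Qed.

Definition glue (S1 : {set edg G1}) (S2 : {set edg G2}) : {set edg G} :=
  [set e : csum_edg d1 d2 | match e with inl x => val x \in S1 | inr y => val y \in S2 end].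

Lemma mem_glue1 S1 S2 x : (j1 x \in glue S1 S2) = (val x \in S1).
Proof. by rewrite inE. Qed.

Lemma mem_glue2 S1 S2 x : (j2 x \in glue S1 S2) = (val x \in S2).
Proof. by rewrite inE. Qed.

Lemma res_glue1 S1 S2 : res j1 (glue S1 S2) = S1 :\ d1.
Proof.
apply/setP => e; rewrite !inE; case: (eqVneq e d1) => [->|ed].
  by rewrite (negPf (notin_res _ _)).
by rewrite -(SubK [the subType _ of {e | e != d1}] ed) mem_res mem_glue1.
Qed.

Lemma res_glue2 S1 S2 : res j2 (glue S1 S2) = S2 :\ d2.
Proof.
apply/setP => e; rewrite !inE; case: (eqVneq e d2) => [->|ed].
  by rewrite (negPf (notin_res _ _)).
by rewrite -(SubK [the subType _ of {e | e != d2}] ed) mem_res mem_glue2.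
Qed.

Definition split_pair (p : {set edg G} * {set edg G}) : eta_V G1 G2 :=
  ((completion j1 p.1, completion j1 p.2), (completion j2 p.1, completion j2 p.2)).

Definition glue_pair (q : eta_V G1 G2) : {set edg G} * {set edg G} :=
  (glue q.1.1 q.2.1, glue q.1.2 q.2.2).

Lemma split_pairK : cancel split_pair glue_pair.
Proof.
move=> [S T]; rewrite /glue_pair /=; congr pair; apply/setP => -[] x.
- by rewrite mem_glue1 mem_completion.
- by rewrite mem_glue2 mem_completion.
- by rewrite mem_glue1 mem_completion.
- by rewrite mem_glue2 mem_completion.
Qed.

Lemma completion_glue1 S1 S2 : basis S1 -> completion j1 (glue S1 S2) = S1.
Proof. by move=> b1; rewrite /completion res_glue1 spans_basisD1 // negbK adjoin_setD1. Qed.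

Lemma completion_glue2 S1 S2 : basis S2 -> completion j2 (glue S1 S2) = S2.
Proof. by move=> b2; rewrite /completion res_glue2 spans_basisD1 // negbK adjoin_setD1. Qed.

(** Each virtual edge lies in exactly one tree of its pair, so the two excluded coincidences become
    one equation. *)
Lemma eta_vertexP q : eta_vertex d1 d2 q <->
  [/\ tau_vertex q.1, tau_vertex q.2 & (d1 \in q.1.1) = (d2 \notin q.2.1)].
Proof.
split=> [[v1 [v2 n]]|[v1 v2 bal]].
  split=> //; case/(tau_vertexP (tau_vertex_conn v1)): v1 => _ _ c1.
  case/(tau_vertexP (tau_vertex_conn v2)): v2 => _ _ c2; move: n; rewrite c1 c2.
  by case: (d1 \in _); case: (d2 \in _) => // -[]; auto.
split=> //; split=> //; case/(tau_vertexP (tau_vertex_conn v1)): v1 => _ _ c1.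
case/(tau_vertexP (tau_vertex_conn v2)): v2 => _ _ c2; rewrite c1 c2 bal.
by case: (d2 \in _) => -[] [].
Qed.

Hypothesis gl : @glued G G1 G2 d1 d2 i1 i2 j1 j2.
Hypotheses (bi1 : bispanning G1) (bi2 : bispanning G2).
Hypothesis conG : forall u v : vtx G, conn [set: edg G] u v.

Let con1 := bispanning_conn bi1.
Let con2 := bispanning_conn bi2.

Lemma split_pair_vertex p : tau_vertex p -> eta_vertex d1 d2 (split_pair p).
Proof.
case/(tau_vertexP conG) => bS bT c; apply/eta_vertexP.
(* These pairs serve as reference for the edge counts; [p1] also shows that [d1] is neither a loop
   nor a bridge. *)
have [p1 v1] := bispanning_tau bi1; have [p2 v2] := bispanning_tau bi2.
have [nl1 nc1] := tau_vertex_nonloop d1 v1.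
have x12 S (bS' : basis S) := restrict_basis_xor gl bS' nl1 nc1.
have x21 S (bS' : basis S) : spans (res j1 S) d1 = ~~ spans (res j2 S) d2.
  by rewrite x12 // negbK.
have b1 S (bS' : basis S) := completion_basis gl bS' (x12 S bS').
have b2 S (bS' : basis S) := completion_basis (gluedC gl) bS' (x21 S bS').
have c1 e : e != d1 -> (e \in completion j1 p.2) = (e \notin completion j1 p.1).
  by move=> ed; rewrite -(SubK [the subType _ of {e | e != d1}] ed) !mem_completion c.
have c2 e : e != d2 -> (e \in completion j2 p.2) = (e \notin completion j2 p.1).
  by move=> ed; rewrite -(SubK [the subType _ of {e | e != d2}] ed) !mem_completion c.
split.
- apply/(tau_vertexP con1); split; [exact: b1 | exact: b1 | move=> e].
  (* Off [d1] complementarity is inherited from the sum; at [d1] it follows by counting. *)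
  by have [->|/c1 //] := eqVneq e d1; apply: complement_at v1 _ _ c1; apply: b1.
- apply/(tau_vertexP con2); split; [exact: b2 | exact: b2 | move=> e].
  by have [->|/c2 //] := eqVneq e d2; apply: complement_at v2 _ _ c2; apply: b2.
- by rewrite /= !mem_completion_d negbK x12.
Qed.

Lemma glue_splits S1 S2 : basis S1 -> basis S2 -> (d1 \in S1) = (d2 \notin S2) ->
  splits j1 j2 (glue S1 S2) S1 S2.
Proof. by move=> b1 b2 bal; split=> //; rewrite ?res_glue1 ?res_glue2. Qed.

Lemma glue_pair_splits q : eta_vertex d1 d2 q ->
  [/\ splits j1 j2 (glue q.1.1 q.2.1) q.1.1 q.2.1,
      splits j1 j2 (glue q.1.2 q.2.2) q.1.2 q.2.2,
      forall e, (e \in q.1.2) = (e \notin q.1.1) &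
      forall e, (e \in q.2.2) = (e \notin q.2.1)].
Proof.
case/eta_vertexP => /(tau_vertexP con1)[bS1 bT1 c1] /(tau_vertexP con2)[bS2 bT2 c2] bal.
by split=> //; apply: glue_splits; rewrite // c1 c2 bal.
Qed.

Lemma glue_pair_vertex q : eta_vertex d1 d2 q -> tau_vertex (glue_pair q).
Proof.
case/glue_pair_splits => spS spT c1 c2; apply/(tau_vertexP conG); split.
- exact: splits_basis gl _ _ _ spS.
- exact: splits_basis gl _ _ _ spT.
- by case=> x; rewrite !inE ?c1 ?c2.
Qed.

Lemma glue_pairK q : eta_vertex d1 d2 q -> split_pair (glue_pair q) = q.
Proof.
case: q => [[S1 T1] [S2 T2]] /glue_pair_splits[[b1 b2 _ _ _] [b3 b4 _ _ _] _ _].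
by rewrite /split_pair /= !completion_glue1 // !completion_glue2.
Qed.

(** * Correspondence of arcs and heads *)

Definition embed (e : edg G) : edg G1 + edg G2 :=
  match (e : csum_edg d1 d2) with inl x => inl (val x) | inr y => inr (val y) end.

Lemma arc_glue e f q : eta_vertex d1 d2 q ->
  tau_arc (e, f, glue_pair q) <-> eta_arc d1 d2 (embed e, embed f, q).
Proof.
move=> vq; have [spS spT c1 c2] := glue_pair_splits vq.
have c1' e' : (e' \in q.1.1) = (e' \notin q.1.2) by rewrite c1 negbK.
have c2' e' : (e' \in q.2.1) = (e' \notin q.2.2) by rewrite c2 negbK.
have [v1 v2 bal] := (eta_vertexP q).1 vq.
rewrite (tau_arcE conG) ?glue_pair_vertex // /eta_arc.
case: e f => x [] y /=.
- rewrite (tau_arcE con1) // -(exchange_same gl spS spT c2) -(exchange_same gl spT spS c2').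
  by rewrite (valP x) (valP y); split=> [|[_ []]].
- rewrite (tau_arcE con1) // (tau_arcE con2) //.
  rewrite (exchange_diff gl spS spT c2) (exchange_diff gl spT spS c2').
  split=> [h|[_ [h1 h2]]].
    by split=> //; case/orP: h => /andP[-> ->]; rewrite ?orbT.
  (* Balance rules out an S exchange on one side combined with a T exchange on the other. *)
  case/orP: h1 => h1; case/orP: h2 => h2; rewrite h1 h2 ?orbT //;
    have [_ ] := uniquely_exchangeable_mem h1; have [+ _] := uniquely_exchangeable_mem h2.
    by rewrite c1 c2 bal => ->.
  by rewrite bal => ->.
- have spS' := splitsC spS; have spT' := splitsC spT.
  rewrite (tau_arcE con1) // (tau_arcE con2) //.
  rewrite (exchange_diff (gluedC gl) spS' spT' c1) (exchange_diff (gluedC gl) spT' spS' c1').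
  split=> [h|[_ [h1 h2]]].
    by split=> //; case/orP: h => /andP[-> ->]; rewrite ?orbT.
  case/orP: h1 => h1; case/orP: h2 => h2; rewrite h1 h2 ?orbT //;
    have [_ +] := uniquely_exchangeable_mem h1; have [+ _] := uniquely_exchangeable_mem h2.
    by rewrite c1 c2 bal => /negP.
  by rewrite bal => /negP.
- have spS' := splitsC spS; have spT' := splitsC spT.
  rewrite (tau_arcE con2) // -(exchange_same (gluedC gl) spS' spT' c1).
  rewrite -(exchange_same (gluedC gl) spT' spS' c1').
  by rewrite (valP x) (valP y); split=> [|[_ []]].
Qed.

(** The two heads test [e \in S1] and [d2 \in S2]; the arc in [G1] and balance make these tests
    agree. *)
Lemma eta_head_diff1 e f q : eta_arc d1 d2 (inl e, inr f, q) ->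
  eta_head d1 d2 (inl e, inr f, q) = (tau_head (e, d1, q.1), tau_head (d2, f, q.2)).
Proof.
case: q => -[S1 T1] [S2 T2] [/eta_vertexP[_ _ bal] [/tau_arc_mem a1 _]].
rewrite /= in bal a1; rewrite /tau_head /= -[d2 \in S2]negbK -bal a1 negbK.
by case: ifP.
Qed.

Lemma eta_head_diff2 e f q : eta_arc d1 d2 (inr e, inl f, q) ->
  eta_head d1 d2 (inr e, inl f, q) = (tau_head (d1, f, q.1), tau_head (e, d2, q.2)).
Proof.
case: q => -[S1 T1] [S2 T2] [/eta_vertexP[_ _ bal] [/tau_arc_mem a1 _]].
rewrite /= in bal a1; rewrite /tau_head /= bal a1 negbK.
by case: ifP.
Qed.

Lemma head_glue e f q : eta_arc d1 d2 (embed e, embed f, q) ->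
  eta_vertex d1 d2 (eta_head d1 d2 (embed e, embed f, q)) /\
  glue_pair (eta_head d1 d2 (embed e, embed f, q)) = tau_head (e, f, glue_pair q).
Proof.
move=> a; have vq : eta_vertex d1 d2 q by case: a.
have a' := (arc_glue e f vq).2 a.
(* A pair is determined by its first tree, so comparing toggled edges there suffices. *)
suff [vh E] : eta_vertex d1 d2 (eta_head d1 d2 (embed e, embed f, q)) /\
    forall g, (g \in (glue_pair (eta_head d1 d2 (embed e, embed f, q))).1) =
              (g \in (glue_pair q).1) (+) ((g == e) || (g == f)).
  split=> //; apply: tau_vertex_inj; first exact: glue_pair_vertex.
    exact: tau_head_vertex.
  by apply/setP => g; rewrite E mem_tau_head.
have [v1 v2 bal] := (eta_vertexP q).1 vq.
have j1E (x y : {e : edg G1 | e != d1}) : (j1 x == j1 y) = (val x == val y).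
  by rewrite (inj_eq (glued_injE1 gl)) val_eqE.
have j2E (x y : {e : edg G2 | e != d2}) : (j2 x == j2 y) = (val x == val y).
  by rewrite (inj_eq (glued_injE2 gl)) val_eqE.
have n12 x y : (j1 x == j2 y) = false := glued_neq gl x y.
have n21 x y : (j2 x == j1 y) = false := glued_neq (gluedC gl) x y.
have dE1 (x : {e : edg G1 | e != d1}) : (d1 == val x) = false.
  by rewrite eq_sym (negPf (valP x)).
have dE2 (x : {e : edg G2 | e != d2}) : (d2 == val x) = false.
  by rewrite eq_sym (negPf (valP x)).
case: e f a {a'} => x [] y a.
- have -> : eta_head d1 d2 (embed (inl x), embed (inl y), q) =
      (tau_head (val x, val y, q.1), q.2) by case: (q) => -[? ?] [].
  case: a => _ [a1 _]; split.
    apply/eta_vertexP; split; [exact: (tau_head_vertex con1) | by [] | ].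
    by rewrite [(_, _).1]/= mem_tau_head // !dE1 addbF.
  case=> z; rewrite /glue_pair /=.
    by rewrite -/(j1 x) -/(j1 y) -/(j1 z) !mem_glue1 mem_tau_head // !j1E.
  by rewrite -/(j1 x) -/(j1 y) -/(j2 z) ?n21 ?addbF !mem_glue2.
- rewrite (eta_head_diff1 a); case: a => _ [a1 a2]; split.
    apply/eta_vertexP; split; [exact: (tau_head_vertex con1) | exact: (tau_head_vertex con2) | ].
    (* Both [d1] and [d2] are toggled, so balance survives. *)
    by rewrite /= !mem_tau_head // !eqxx dE1 dE2 bal; case: (d2 \in _).
  case=> z; rewrite /glue_pair /=.
    rewrite -/(j1 x) -/(j2 y) -/(j1 z) !mem_glue1 mem_tau_head // j1E ?n12.
    by rewrite (negPf (valP z)) ?orbF.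
  rewrite -/(j1 x) -/(j2 y) -/(j2 z) !mem_glue2 mem_tau_head // j2E ?n21.
  by rewrite (negPf (valP z)) ?orbF.
- rewrite (eta_head_diff2 a); case: a => _ [a2 a1]; split.
    apply/eta_vertexP; split; [exact: (tau_head_vertex con1) | exact: (tau_head_vertex con2) | ].
    by rewrite /= !mem_tau_head // !eqxx dE1 dE2 bal; case: (d2 \in _).
  case=> z; rewrite /glue_pair /=.
    rewrite -/(j2 x) -/(j1 y) -/(j1 z) !mem_glue1 mem_tau_head // j1E ?n12.
    by rewrite (negPf (valP z)) ?orbF.
  rewrite -/(j2 x) -/(j1 y) -/(j2 z) !mem_glue2 mem_tau_head // j2E ?n21.
  by rewrite (negPf (valP z)) ?orbF.
- have -> : eta_head d1 d2 (embed (inr x), embed (inr y), q) =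
      (q.1, tau_head (val x, val y, q.2)) by case: (q) => -[? ?] [].
  case: a => _ [a1 _]; split.
    apply/eta_vertexP; split; [by [] | exact: (tau_head_vertex con2) | ].
    by rewrite [(_, _).2]/= mem_tau_head // !dE2 addbF.
  case=> z; rewrite /glue_pair /=.
    by rewrite -/(j2 x) -/(j2 y) -/(j1 z) ?n12 ?addbF !mem_glue1.
  by rewrite -/(j2 x) -/(j2 y) -/(j2 z) !mem_glue2 mem_tau_head // !j2E.
Qed.

(** The default [e0] is the value at virtual edges, which [eta_arc_embed] excludes from the entries
    of arcs. *)
Definition unembed (e0 : edg G) (e : edg G1 + edg G2) : edg G :=
  match e with
  | inl e => if insub e is Some x then j1 x else e0
  | inr e => if insub e is Some y then j2 y else e0
  end.

Lemma embedK e0 : cancel embed (unembed e0).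
Proof. by case=> x; rewrite /= valK. Qed.

Lemma unembedK e0 e : e != inl d1 -> e != inr d2 -> embed (unembed e0 e) = e.
Proof. by case: e => e /= h1 h2; rewrite insubT. Qed.

(** In the mixed cases a virtual edge as [e] or [f] would be exchanged with itself. *)
Lemma eta_arc_embed e f q : eta_arc d1 d2 (e, f, q) ->
  [/\ e != inl d1, e != inr d2, f != inl d1 & f != inr d2].
Proof.
have neq (H : graph) (a b : edg H) p : tau_arc (a, b, p) -> a != b.
  by move/tau_arc_mem; apply: contra_eqN => /eqP->; case: (_ \in _).
case=> _; case: e f => e [] f.
- by case=> _ [].
- by case=> /neq ? /neq; rewrite eq_sym.
- by case=> /neq ? /neq; rewrite eq_sym.
- by case=> _ [].
Qed.

(** [d1] is no loop, yet the other edges join its ends, so there are other edges; one serves as the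
    default of [unembed]. *)
Lemma csum_edge : inhabited (edg G).
Proof.
have [p vp] := bispanning_tau bi1; have [nl nc] := tau_vertex_nonloop d1 vp.
have /set0Pn[e] : [set~ d1] != set0 by apply: contraNneq nl => <-.
by rewrite !inE => ed; exists; apply: j1 (Sub e ed).
Qed.

Lemma tau3_csum_iso : dmg_iso (tau3 G) (eta d1 d2).
Proof.
have [e0] := csum_edge.
exists split_pair, glue_pair, (fun a => (embed a.1.1, embed a.1.2, split_pair a.2)),
  (fun b => (unembed e0 b.1.1, unembed e0 b.1.2, glue_pair b.2)) => /=.
split; first by move=> p vp; split; [exact: split_pair_vertex | exact: split_pairK].
split; first by move=> q vq; split; [exact: glue_pair_vertex | exact: glue_pairK].
have arcV e f p : @tau_arc G (e, f, p) -> tau_vertex p by case/andP.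
have split_arc e f p : @tau_arc G (e, f, p) -> eta_arc d1 d2 (embed e, embed f, split_pair p).
  move=> a; apply/(arc_glue e f (split_pair_vertex (arcV _ _ _ a))).
  by rewrite split_pairK.
split.
  move=> [[e f] p] a; split; first exact: split_arc.
  by rewrite !embedK split_pairK.
split.
  move=> [[e f] q] b; have [n1 n2 n3 n4] := eta_arc_embed b.
  have vq : eta_vertex d1 d2 q by case: b.
  rewrite /= !unembedK // glue_pairK //; split=> //.
  by apply/(arc_glue _ _ vq); rewrite !unembedK.
(* The clause on tails holds by computation; for heads, [split_pair] is applied to the equality of
   glued heads. *)
move=> [[e f] p] a; split=> //; have [vh E] := head_glue (split_arc _ _ _ a).
by have := glue_pairK vh; rewrite E split_pairK => /esym.
Qed.

End CliqueSum.

Theorem mainTheorem2 (G1 G2 : graph) (d1 : edg G1) (d2 : edg G2)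
  (V : finType) (i1 : vtx G1 -> V) (i2 : vtx G2 -> V) :
  simple G1 -> simple G2 -> bispanning G1 -> bispanning G2 ->
  clique_sum_maps d1 d2 i1 i2 ->
  atomic (csum d1 d2 i1 i2) ->
  vertex_connectivity (csum d1 d2 i1 i2) 2 ->
  dmg_iso (tau3 (csum d1 d2 i1 i2)) (eta d1 d2).
Proof.
move=> _ _ bi1 bi2 /csum_glued gl [bi _] _.
exact: tau3_csum_iso gl bi1 bi2 (bispanning_conn bi).
Qed.
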